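(* Let $N\ge3$ and let $\mathcal{H}$ be an undirected hypergraph on $\{1,\dots,N\}$. Consider any network dynamical system on $\mathcal{H}$ with one-dimensional node states, smooth $F$ and coupling homogeneous in each order. Then the system does not realize the Field cycle: there do not exist distinct $i,j\in\{1,\dots,N\}$ such that $\Delta$, $S_i$, $S_j$ are dynamically invariant, together with two distinct hyperbolic equilibria $\xi_1,\xi_2\in\Delta$, a heteroclinic trajectory from $\xi_1$ to $\xi_2$ contained in $S_i\setminus\Delta$ and a heteroclinic trajectory from $\xi_2$ to $\xi_1$ contained in $S_j\setminus\Delta$.
   Context: An undirected hypergraph on $\{1,\dots,N\}$ is a set $\mathcal E$ of nonempty subsets $A\subseteq\{1,\dots,N\}$ (undirected hyperedges, identified with directed hyperedges $(A,A)$); the order of $A$ is $|A|+1$. A network dynamical system with coupling homogeneous in each order on it is $\dot x_k = F(x_k) + \sum_{A\in\mathcal{E}:\,k\in A} G^{(|A|+1)}(x_k; x_A)$ on $\mathbb{R}^N$, where $x_A$ is the vector of $x_j$, $j\in A$ (including $x_k$), $F$ is smooth, and $G^{(m)}:\mathbb{R}\times\mathbb{R}^{m-1}\to\mathbb{R}$ is smooth, symmetric in its last $m-1$ arguments and depends nontrivially on them. $\Delta=\{x_1=\dots=x_N\}$ and $S_j=\{x: x_l=x_k \text{ for all } k,l\neq j\}$. A heteroclinic trajectory from $\xi$ to $\xi'$ is a solution $x(t)$, $t\in\mathbb R$, with $x(t)\to\xi$ as $t\to-\infty$ and $x(t)\to\xi'$ as $t\to+\infty$; an equilibrium is hyperbolic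 if its Jacobian has no eigenvalue with zero real part. *)

(* Defs.v *)
From HB Require Import structures.
From mathcomp Require Import all_boot all_order all_fingroup all_algebra.
From mathcomp Require Import all_classical all_reals all_analysis.
From mathcomp.real_closed Require Import complex.
Set Implicit Arguments.
Unset Strict Implicit.
Unset Printing Implicit Defensive.
Import Order.TTheory GRing.Theory Num.Theory.
Import numFieldNormedType.Exports.
Local Open Scope classical_set_scope.
Local Open Scope ring_scope.

Section NetworkDefs.
Variable R : realType.

Fixpoint iter_partial (n : nat) (s : seq 'I_n) (f : 'rV[R]_n -> R) : 'rV[R]_n -> R :=
  if s is i :: s' then (fun x => 'D_(delta_mx ord0 i) (iter_partial s' f) x) else f.

Definition smooth_fun (n : nat) (f : 'rV[R]_n -> R) : Prop :=
  forall s : seq 'I_n, continuous (iter_partial s f) /\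
    (forall (i : 'I_n) (x : 'rV[R]_n), derivable (iter_partial s f) x (delta_mx ord0 i)).

Definition smooth_fun1 (F : R -> R) : Prop :=
  smooth_fun (fun z : 'rV[R]_1 => F (z ord0 ord0)).

Definition smooth_coupling (n : nat) (g : R -> 'rV[R]_n -> R) : Prop :=
  smooth_fun (fun z : 'rV[R]_(1 + n) =>
    g (z ord0 (lshift n ord0)) (\row_(k < n) z ord0 (rshift 1 k))).

Definition symmetric_coupling (n : nat) (g : R -> 'rV[R]_n -> R) : Prop :=
  forall (s : {perm 'I_n}) (x : R) (y : 'rV[R]_n), g x (col_perm s y) = g x y.

Definition nontrivial_coupling (n : nat) (g : R -> 'rV[R]_n -> R) : Prop :=
  exists (x : R) (y y' : 'rV[R]_n), g x y <> g x y'.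

Definition sub_state (N : nat) (x : 'rV[R]_N) (A : {set 'I_N}) : 'rV[R]_#|A| :=
  \row_(k < #|A|) x ord0 (enum_val k).

(* the vector field
   (V x)_k = F(x_k) + sum_{A in E, k in A} G^{(|A|+1)}(x_k; x_A),
   where G n is G^{(n+1)} (it takes x_k and n further arguments) *)
Definition net_vf (N : nat) (E : {set {set 'I_N}}) (F : R -> R)
    (G : forall n : nat, R -> 'rV[R]_n -> R) (x : 'rV[R]_N) : 'rV[R]_N :=
  \row_(k < N) (F (x ord0 k) +
     \sum_(A in E | k \in A) G #|A| (x ord0 k) (sub_state x A)).

Definition diagonal_set (N : nat) : set 'rV[R]_N :=
  [set x | forall k l : 'I_N, x ord0 k = x ord0 l].

Definition S_set (N : nat) (j : 'I_N) : set 'rV[R]_N :=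
  [set x | forall k l : 'I_N, k != j -> l != j -> x ord0 k = x ord0 l].

Definition is_solution (N : nat) (V : 'rV[R]_N -> 'rV[R]_N) (I : set R)
    (y : R -> 'rV[R]_N) : Prop :=
  forall t, I t -> is_derive t 1 y (V (y t)).

Definition open_interval (I : set R) : Prop :=
  open I /\ (forall s t u, I s -> I u -> s <= t <= u -> I t).

Definition dyn_invariant (N : nat) (V : 'rV[R]_N -> 'rV[R]_N) (S : set 'rV[R]_N) : Prop :=
  forall (I : set R) (y : R -> 'rV[R]_N), open_interval I -> is_solution V I y ->
    forall t0 t, I t0 -> I t -> S (y t0) -> S (y t).

Definition is_equilibrium (N : nat) (V : 'rV[R]_N -> 'rV[R]_N) (xi : 'rV[R]_N) : Prop :=
  V xi = 0.

Definition jacobian (N : nat) (V : 'rV[R]_N -> 'rV[R]_N) (xi : 'rV[R]_N) : 'M[R]_N :=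
  \matrix_(k < N, l < N) 'D_(delta_mx ord0 l) (fun x => V x ord0 k) xi.

Definition hyperbolic (N : nat) (V : 'rV[R]_N -> 'rV[R]_N) (xi : 'rV[R]_N) : Prop :=
  forall lam : R[i], Re lam = 0 ->
    ~~ eigenvalue (map_mx (real_complex R) (jacobian V xi)) lam.

Definition heteroclinic_in (N : nat) (V : 'rV[R]_N -> 'rV[R]_N)
    (xi xi' : 'rV[R]_N) (S : set 'rV[R]_N) : Prop :=
  exists y : R -> 'rV[R]_N,
    is_solution V setT y /\
    (y t @[t --> -oo] --> xi) /\ (y t @[t --> +oo] --> xi') /\
    (forall t, S (y t)).

End NetworkDefs.
Arguments diagonal_set {R} N _.

(* Main.v *)
Require Import Defs.
From HB Require Import structures.
From mathcomp Require Import all_boot all_order all_fingroup all_algebra.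
From mathcomp Require Import all_classical all_reals all_analysis.
From mathcomp.real_closed Require Import complex.
From mathcomp Require Import ring lra.
Import Order.TTheory GRing.Theory Num.Theory.
Import numFieldNormedType.Exports.
Local Open Scope classical_set_scope.
Local Open Scope ring_scope.

(** At a diagonal equilibrium the Jacobian [J] has symmetric off-diagonal part, because an
    undirected hyperedge couples its nodes symmetrically.  Invariance of [S_i] and [S_j] makes
    columns [i] and [j] constant off the diagonal, with the common value [a = J_ij = J_ji], and
    invariance of [Delta] makes the row sums equal; hence [J_ii = J_jj].  So the eigenvalue
    [mu = J_ii - a] transverse to [Delta] is the same in [S_i] and in [S_j].  At [xi_1] the
    trajectory leaving inside [S_i] forces [mu >= 0] and the one arriving inside [S_j] forces
    [mu <= 0], which contradicts hyperbolicity.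

    Passing from dynamical invariance to identities for the vector field requires a local
    solution through every point, whence the Picard iteration. *)

(** * Calculus on row vectors *)

Lemma row_norm_le {R : realType} {n : nat} (x : 'rV[R]_n) (r : R) :
  0 <= r -> (forall k, `|x ord0 k| <= r) -> `|x| <= r.
Proof.
move=> r0 xr; rewrite [leLHS]/Num.Def.normr/= mx_normrE (bigmax_le _ r0)//=.
by move=> -[i j] _ /=; rewrite ord1.
Qed.

Lemma coord_norm_le {R : realType} {n : nat} (x : 'rV[R]_n) (k : 'I_n) :
  `|x ord0 k| <= `|x|.
Proof.
by rewrite [leRHS]/Num.Def.normr/= mx_normrE; exact: (le_bigmax _ _ (ord0, k)).
Qed.

Lemma is_derive_row {R : realType} {n : nat} (y : R -> 'rV[R]_n) (v : 'rV[R]_n)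
    (t : R) :
  (forall k, is_derive t 1 (fun s => y s ord0 k) (v ord0 k)) -> is_derive t 1 y v.
Proof.
move=> dy; have yd : derivable y t 1.
  by apply/derivable_mxP => i k; rewrite ord1; case: (dy k).
split=> //; rewrite derive_mx//; apply/rowP => k; rewrite mxE.
by case: (dy k).
Qed.

Lemma is_derive_coord {R : realType} {n : nat} (y : R -> 'rV[R]_n) (v : 'rV[R]_n)
    (t : R) (k : 'I_n) :
  is_derive t 1 y v -> is_derive t 1 (fun s => y s ord0 k) (v ord0 k).
Proof.
case=> yd <-; split; first by move/derivable_mxP : yd; apply.
by rewrite derive_mx// mxE.
Qed.

(** The intervals [[u m - r m, u m + r m]] are nested, since each step of the centre is at most the
    loss in radius; the supremum of the left endpoints lies in all of them. The error bound [r m]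
    comes with the limit. *)
Lemma nested_limit {R : realType} (u r : nat -> R) :
  (forall m, 0 <= r m) -> (forall m, `|u m.+1 - u m| <= r m - r m.+1) ->
  exists l, forall m, `|l - u m| <= r m.
Proof.
move=> r0 ur; pose A := range (fun m => u m - r m).
have lo m p : u m - r m <= u (m + p)%N - r (m + p)%N.
  elim: p => [|p IH]; rewrite ?addn0// addnS (le_trans IH)//.
  by have := ur (m + p)%N; rewrite ler_norml => /andP[] *; lra.
have hi m p : u (m + p)%N + r (m + p)%N <= u m + r m.
  elim: p => [|p IH]; rewrite ?addn0// addnS (le_trans _ IH)//.
  by have := ur (m + p)%N; rewrite ler_norml => /andP[] *; lra.
have ubA m : ubound A (u m + r m).
  (* The left endpoint of index [p] and the right endpoint of index [m] are compared through the
     interval of index [m + p]. *)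
  move=> _ [p _ <-]; have := lo p m; have := hi m p.
  by rewrite (addnC p m); have := r0 (m + p)%N; lra.
exists (sup A) => m; have A0 : A !=set0 by exists (u 0%N - r 0%N), 0%N.
have h1 : sup A <= u m + r m by apply: ge_sup => //; exact: ubA.
have h2 : u m - r m <= sup A.
  by apply: ub_le_sup; [exists (u 0%N + r 0%N); exact: ubA|exists m].
by rewrite ler_norml; apply/andP; split; lra.
Qed.

Lemma mean_value_bound {R : realType} (h dh : R -> R) (b C : R) :
  (forall t : R, `|t| < b -> is_derive t 1 h (dh t)) ->
  (forall t, `|t| < b -> `|dh t| <= C) ->
  forall t, `|t| < b -> `|h t - h 0| <= C * `|t|.
Proof.
move=> hd hC.
have cont s t : `|s| < b -> `|t| < b -> {within `[s, t], continuous h}.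
  move=> sb tb; apply: derivable_within_continuous => z; rewrite in_itv/= => /andP[sz zt].
  have zb : `|z| < b by move: sb tb; rewrite !ltr_norml => /andP[? ?] /andP[? ?]; lra.
  by case: (hd z zb).
have inb s t z : `|s| < b -> `|t| < b -> z \in `]s, t[%R -> `|z| < b.
  rewrite in_itv/= !ltr_norml => /andP[? ?] /andP[? ?] /andP[? ?]; lra.
move=> t tb; have b0 : `|0 : R| < b by rewrite normr0 (le_lt_trans _ tb).
have [t0|t0|->] := ltgtP t 0; last by rewrite subrr !normr0 mulr0.
- have [|c cb e] := @MVT _ h dh t 0 t0 _ (cont _ _ tb b0).
    by move=> z zt; apply: hd; apply: inb zt.
  by rewrite distrC e normrM sub0r normrN ler_wpM2r// hC//; apply: inb cb.
- have [|c cb e] := @MVT _ h dh 0 t t0 _ (cont _ _ b0 tb).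
    by move=> z zt; apply: hd; apply: inb zt.
  by rewrite e normrM subr0 ler_wpM2r// hC//; apply: inb cb.
Qed.

(** The oriented integral of [f] from 0 to [t], for [t] of either sign: starting both integrals at
    [- b] lets one application of the fundamental theorem on [[- b, b]] cover all [|t| < b]. *)
Definition primitive_from {R : realType} (b : R) (f : R -> R) (t : R) : R :=
  (\int[@lebesgue_measure R]_(s in [set` `[- b, t]]) f s)%R -
  (\int[@lebesgue_measure R]_(s in [set` `[- b, 0]]) f s)%R.

Lemma primitive_from0 {R : realType} (b : R) (f : R -> R) : primitive_from b f 0 = 0.
Proof. exact: subrr. Qed.

Lemma is_derive_primitive_from {R : realType} (b : R) (f : R -> R) (t : R) :
  continuous f -> `|t| < b -> is_derive t 1 (primitive_from b f) (f t).
Proof.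
move=> cf; rewrite ltr_norml => /andP[bt tb].
have intf : (@lebesgue_measure R).-integrable `[- b, b] (EFin \o f).
  apply: continuous_compact_integrable; first exact: segment_compact.
  exact: continuous_subspaceT.
have [d1 d2] := continuous_FTC1_closed tb intf bt (cf t).
have -> : primitive_from b f = (fun x => (\int[@lebesgue_measure R]_(s in [set` `[- b, x]]) f s)%R) - cst ((\int[@lebesgue_measure R]_(s in [set` `[- b, 0]]) f s)%R).
  by [].
rewrite -[f t]subr0; apply: is_deriveB.
by split; [exact: d1|rewrite -derive1E; exact: d2].
Qed.

(** * Local existence of solutions *)

Lemma is_derive_continuous {R : realType} {V : normedModType R} (f : R -> V) (t : R)
    (df : V) :
  is_derive t 1 f df -> {for t, continuous f}.
Proof. by case=> fd _; apply/differentiable_continuous/derivable1_diffP. Qed.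

Definition clip {R : realType} (c r x : R) : R := Num.max (c - r) (Num.min (c + r) x).

Lemma clip_lip {R : realType} (c r x y : R) : `|clip c r x - clip c r y| <= `|x - y|.
Proof.
rewrite /clip /Num.max /Num.min.
have := ler_norm (x - y); have := ler_norm (y - x); rewrite (distrC y x).
by repeat case: ifPn => [|]; rewrite -?leNgt ler_norml => *; apply/andP; split; lra.
Qed.

Lemma clip_near {R : realType} (c r x : R) : 0 <= r -> `|clip c r x - c| <= r.
Proof.
move=> r0; rewrite /clip /Num.max /Num.min.
by repeat case: ifPn => [|]; rewrite -?leNgt ler_norml => *; apply/andP; split; lra.
Qed.

Lemma clip_id {R : realType} (c r x : R) : `|x - c| <= r -> clip c r x = x.
Proof.
rewrite ler_norml => /andP[? ?]; rewrite /clip /Num.max /Num.min.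
by repeat case: ifPn => [|]; rewrite -?leNgt => *; lra.
Qed.

Lemma clip_continuous {R : realType} (c r : R) : continuous (clip c r).
Proof.
move=> x; apply/cvgrPdist_lt => e e0; near=> y.
apply: le_lt_trans (clip_lip _ _ _ _) _; near: y.
exact: cvgr_dist_lt.
Unshelve. all: end_near. Qed.

Lemma row_continuous {R : realType} {n : nat} (y : R -> 'rV[R]_n) (t : R) :
  (forall k, {for t, continuous (fun s => y s ord0 k)}) -> {for t, continuous y}.
Proof.
move=> yc; apply/cvgrPdist_le => e e0; near=> s.
apply: row_norm_le; first exact: ltW.
move=> k; rewrite !mxE; move: k; near: s; apply: filter_forall => k.
by apply: cvgr_dist_le => //; exact: (yc k).
Unshelve. all: end_near. Qed.

Lemma lipschitz_bound_continuous {R : realType} {V V' : normedModType R}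
    (f : V -> V') (L : R) :
  0 < L -> (forall x y, `|f x - f y| <= L * `|x - y|) -> continuous f.
Proof.
move=> L0 fL x; apply/cvgrPdist_lt => e e0; near=> y.
apply: le_lt_trans (fL _ _) _; rewrite -ltr_pdivlMl//; near: y.
by apply: cvgr_dist_lt => //; rewrite mulr_gt0 ?invr_gt0.
Unshelve. all: end_near. Qed.

Section Picard.
Context {R : realType} {n : nat}.
Variables (W : 'rV[R]_n -> 'rV[R]_n) (L : R) (x0 : 'rV[R]_n).
Hypothesis L0 : 0 < L.
Hypothesis Wlip : forall x y, `|W x - W y| <= L * `|x - y|.

(** The choice [L * a = 1/2] makes the Picard operator halve distances. Times clipped to [[- a, a]]
    stay strictly inside [|t| < b], where [primitive_from b] is differentiable. *)
Let a : R := (2 * L)^-1.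
Let b : R := 2 * a.

Let a0 : 0 < a. Proof. by rewrite invr_gt0 mulr_gt0. Qed.

Let clipb t : `|clip 0 a t| < b.
Proof. by have := clip_near 0 a t (ltW a0); rewrite subr0 /b; have := a0; lra. Qed.

Let Wcont : continuous W.
Proof. exact: lipschitz_bound_continuous L0 Wlip. Qed.

(* Clipping the time makes the Picard operator a contraction on the whole line. *)
Let T (y : R -> 'rV[R]_n) (t : R) : 'rV[R]_n :=
  \row_k (x0 ord0 k + primitive_from b (fun s => W (y s) ord0 k) (clip 0 a t)).

Let Wy_cont (y : R -> 'rV[R]_n) k :
  continuous y -> continuous (fun s => W (y s) ord0 k).
Proof.
move=> yc s; apply: (@continuous_comp _ _ _ (fun s => W (y s)) (fun M => M ord0 k)).
  exact: (continuous_comp (yc s) (Wcont (y s))).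
exact: coord_continuous.
Qed.

Let T_cont y : continuous y -> continuous (T y).
Proof.
move=> yc t; apply: row_continuous => k.
rewrite /prop_for (_ : (fun s => T y s ord0 k) = (fun s => x0 ord0 k +
  primitive_from b (fun s => W (y s) ord0 k) (clip 0 a s))); last first.
  by apply: funext => s; rewrite mxE.
apply: cvgD; first exact: cvg_cst.
apply: (@continuous_comp _ _ _ (clip 0 a) (primitive_from b (fun s => W (y s) ord0 k))).
  exact: clip_continuous.
apply: is_derive_continuous.
exact: (is_derive_primitive_from _ _ _ (Wy_cont y k yc)).
Qed.

(** The difference of the two primitives vanishes at 0 and has slope at most [L * M]; the clipped
    time is at most [a] in absolute value, and [L * M * a = M / 2]. *)
Let T_lip y z (M : R) : continuous y -> continuous z ->
  (forall t, `|y t - z t| <= M) -> forall t, `|T y t - T z t| <= M / 2.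
Proof.
move=> yc zc yz t; have M0 : 0 <= M by rewrite (le_trans _ (yz 0)).
apply: row_norm_le => [|k]; first by rewrite divr_ge0.
rewrite !mxE opprD addrACA subrr add0r.
set f := fun s => W (y s) ord0 k; set g := fun s => W (z s) ord0 k.
have [fc gc] : continuous f /\ continuous g by split; exact: Wy_cont.
have := @mean_value_bound R (fun s => primitive_from b f s - primitive_from b g s)
  (fun s => f s - g s) b (L * M) _ _ (clip 0 a t) (clipb t).
rewrite /= !primitive_from0 !subr0 => H; apply: le_trans (H _ _) _.
- by move=> s sb; apply: is_deriveB; exact: is_derive_primitive_from.
- move=> s _; have -> : f s - g s = (W (y s) - W (z s)) ord0 k by rewrite !mxE.
  apply: le_trans (coord_norm_le _ _) _; apply: le_trans (Wlip _ _) _.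
  by rewrite ler_pM2l.
- have := clip_near 0 a t (ltW a0); rewrite subr0 => ct.
apply: (@le_trans _ _ (L * M * a)).
  by rewrite ler_wpM2l// mulr_ge0// ltW.
by rewrite /a; have := L0; rewrite le_eqVlt => ?; apply/orP; left; apply/eqP; field; lra.
Qed.

Let u (m : nat) : R -> 'rV[R]_n := iter m T (fun=> x0).

Let u_cont m : continuous (u m).
Proof. by elim: m => [|m IH]; [move=> ?; exact: cst_continuous|exact: T_cont]. Qed.

Let C : R := `|W x0| * a.

Let u_step m t : `|u m.+1 t - u m t| <= C / 2 ^+ m.
Proof.
elim: m t => [|m IH] t; last first.
  have -> : C / 2 ^+ m.+1 = C / 2 ^+ m / 2 by rewrite exprSr invfM mulrA.
  exact: (T_lip _ _ _ (u_cont m.+1) (u_cont m) IH).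
rewrite expr0 divr1 /u/=; apply: row_norm_le => [|k].
  by rewrite /C mulr_ge0// ltW.
rewrite !mxE addrAC subrr add0r.
have := @mean_value_bound R (primitive_from b (fun=> W x0 ord0 k))
  (fun=> W x0 ord0 k) b `|W x0| _ _ (clip 0 a t) (clipb t).
rewrite primitive_from0 subr0 => H; apply: le_trans (H _ _) _.
- by move=> s sb; apply: (is_derive_primitive_from b (fun=> W x0 ord0 k)) => // ?; exact: cst_continuous.
- by move=> s _; exact: coord_norm_le.
rewrite /C ler_wpM2l//.
by have := clip_near 0 a t (ltW a0); rewrite subr0.
Qed.

(** The tail of the geometric series of step bounds [C / 2 ^+ p], [p >= m]; thus [r m - r m.+1] is
    exactly the bound on step [m]. *)
Let r (m : nat) : R := 2 * C / 2 ^+ m.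

Let r_small e : 0 < e -> exists m, r m < e.
Proof.
move=> e0; have := @cvg_geometric R (2 * C) (2^-1).
rewrite ger0_norm ?invr_ge0// invf_lt1// ltr1n => /(_ isT) /cvgrPdist_lt /(_ e e0) [m _ /(_ m)].
move=> /(_ (leqnn m)); rewrite sub0r normrN /= exprVn => h.
by exists m; apply: le_lt_trans h; exact: ler_norm.
Qed.

Let limit_ex : exists y : R -> 'rV[R]_n, forall t m, `|y t - u m t| <= r m.
Proof.
have C0 : 0 <= C by rewrite /C mulr_ge0// ltW.
have r0 m : 0 <= r m by rewrite /r divr_ge0 ?exprn_ge0 ?ler0n// mulr_ge0 ?ler0n.
have h t k : exists l, forall m, `|l - u m t ord0 k| <= r m.
  apply: nested_limit => // m; apply: (@le_trans _ _ (C / 2 ^+ m)).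
    have -> : u m.+1 t ord0 k - u m t ord0 k = (u m.+1 t - u m t) ord0 k by rewrite !mxE.
    exact: le_trans (coord_norm_le _ _) (u_step _ _).
  rewrite /r exprS invfM; lra.
exists (fun t => \row_k sval (cid (h t k))) => t m; apply: row_norm_le => // k.
by rewrite !mxE; exact: (svalP (cid (h t k))).
Qed.

(** The uniform limit of the iterates is a continuous fixed point of [T]. For [|t| < a] the clipping
    is the identity, so the fixed point equation is the integral form of the differential
    equation. *)
Lemma picard : exists2 d : R, 0 < d & exists y : R -> 'rV[R]_n,
  y 0 = x0 /\ forall t : R, `|t| < d -> is_derive t 1 y (W (y t)).
Proof.
have [y yu] := limit_ex; exists a => //.
have yc : continuous y.
  move=> t; apply/cvgrPdist_lt => e e0.
  have [|m rm] := r_small (e / 3); first by rewrite divr_gt0.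
  near=> s.
  have h1 := yu t m; have h2 := yu s m.
  have h3 : `|u m t - u m s| < e / 3.
    near: s; apply: cvgr_dist_lt; [exact: u_cont|by rewrite divr_gt0].
  have -> : y t - y s = (y t - u m t) + (u m t - u m s) - (y s - u m s).
    by rewrite addrA subrK opprB addrA subrK.
  apply: le_lt_trans (ler_normB _ _) _; apply: le_lt_trans (lerD (ler_normD _ _) (lexx _)) _.
  by lra.
have Ty t : T y t = y t.
  apply/eqP; rewrite -subr_eq0 -normr_le0; apply/ler_addgt0Pr => e e0; rewrite add0r.
  have [m rm] := r_small e e0.
  have h1 := T_lip _ _ _ yc (u_cont m) (fun s => yu s m) t.
  have h2 := yu t m.+1.
  (* [T (u m)] is [u m.+1] by definition, and each of the two differences is at most [r m / 2]. *)
  have -> : T y t - y t = (T y t - T (u m) t) - (y t - u m.+1 t) by rewrite opprB addrA subrK.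
  apply: le_trans (ler_normB _ _) _; apply: le_trans (lerD h1 h2) _.
  apply: le_trans (ltW rm); rewrite /r exprS invfM; lra.
exists y; split.
  rewrite -Ty; apply/rowP => k; rewrite mxE clip_id ?primitive_from0 ?addr0//.
  by rewrite subrr normr0 ltW.
move=> t ta; apply: is_derive_row => k.
have tb : `|t| < b by rewrite (lt_trans ta)// /b; have := a0; lra.
have := is_derive_primitive_from b (fun s => W (y s) ord0 k) t (Wy_cont y k yc) tb.
move=> /(is_deriveD (is_derive_cst (x0 ord0 k : R) t 1)); rewrite add0r.
apply: near_eq_is_derive.
near=> s; rewrite -[in RHS]Ty mxE clip_id// subr0 ltW//.
by near: s; apply: cvgr_norm_lt ta; exact: cvg_id.
Unshelve. all: end_near. Qed.
End Picard.

(** * Strict differentiability *)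

(** Strict differentiability: both points move freely near [x]. This single notion gives the local
    Lipschitz bound for Picard, the Jacobian entries, and the comparison of a trajectory with moving
    points of the diagonal. *)
Definition strict_deriv {R : realType} {n : nat} (f : 'rV[R]_n -> R) (x : 'rV[R]_n)
    (c : 'I_n -> R) : Prop :=
  forall e, 0 < e -> exists2 d : R, 0 < d & forall y z,
    `|y - x| < d -> `|z - x| < d ->
    `|f y - f z - \sum_l (y ord0 l - z ord0 l) * c l| <= e * `|y - z|.

Lemma derive_line {R : realType} {n : nat} (f : 'rV[R]_n -> R) (z v : 'rV[R]_n) (s : R) :
  derivable f (z + s *: v) v ->
  is_derive s 1 (fun s : R => f (z + s *: v)) ('D_v f (z + s *: v)).
Proof.
have E : (fun h : R => h^-1 *: (f (h *: v + (z + s *: v)) - f (z + s *: v))) =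
    (fun h : R => h^-1 *: (f (z + (h *: (1 : R) + s) *: v) - f (z + s *: v))).
  apply: funext => h; congr (_ *: (f _ - _)).
  by rewrite [h *: 1]mulr1 scalerDl addrCA.
move=> fd; split; first by move: fd; rewrite /derivable E.
by rewrite /derive /= -E.
Qed.

Lemma delta_norm_le1 {R : realType} {n : nat} (k : 'I_n) :
  `|delta_mx ord0 k : 'rV[R]_n| <= 1.
Proof.
by apply: row_norm_le => // l; rewrite mxE; case: (_ && _); rewrite ?normr1 ?normr0.
Qed.

(** One walks from [z] to [y] changing one coordinate at a time and applies the mean value bound on
    each segment, where the partial derivative is close to its value at [x]. *)
Lemma strict_deriv_C1 {R : realType} {n : nat} (f : 'rV[R]_n -> R) (x : 'rV[R]_n) :
  (forall k y, derivable f y (delta_mx ord0 k)) ->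
  (forall k, continuous ('D_(delta_mx ord0 k) f)) ->
  strict_deriv f x (fun k => 'D_(delta_mx ord0 k) f x).
Proof.
move=> fd fc e e0; pose e' := e / n.+1%:R.
have e'0 : 0 < e' by rewrite divr_gt0.
have xF : Filter (nbhs x) by exact: nbhs_filter.
have : \forall w \near x, forall k,
    `|'D_(delta_mx ord0 k) f x - 'D_(delta_mx ord0 k) f w| < e'.
  apply: (@filter_forall _ _ _ (nbhs x) xF) => k.
  by move/cvgrPdist_lt : (fc k x); apply.
(* The corners [p m] of the path lie within [d / 3] of [x] and the segments are shorter than
   [2 * d / 3], so the path stays in the ball of radius [d]. *)
move=> /nbhs_normP[d /= d0 dP]; exists (d / 3) => [|y z yx zx].
  by rewrite divr_gt0.
pose p (m : nat) : 'rV[R]_n := \row_l (if (l < m)%N then y ord0 l else z ord0 l).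
have p0 : p 0%N = z by apply/rowP => l; rewrite mxE.
have pn : p n = y by apply/rowP => l; rewrite mxE ltn_ord.
have pS (m : 'I_n) : p m.+1 = p m + (y ord0 m - z ord0 m) *: delta_mx ord0 m.
  apply/rowP => l; rewrite !mxE eqxx/= ltnS leq_eqVlt.
  have [->|lm] := eqVneq l m; first by rewrite eqxx ltnn mulr1 addrC subrK.
  by rewrite -val_eqE/= in lm; rewrite (negbTE lm)/= mulr0 addr0.
have px m : `|x - p m| <= d / 3.
  apply: row_norm_le => [|l]; first by rewrite ltW// divr_gt0.
  rewrite !mxE distrC; case: ifP => _.
    by have := coord_norm_le (y - x) l; rewrite !mxE => /le_trans; apply; exact: ltW.
  by have := coord_norm_le (z - x) l; rewrite !mxE => /le_trans; apply; exact: ltW.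
have yz : `|y - z| < d * (2 / 3).
  have -> : y - z = (y - x) - (z - x) by rewrite opprB addrA subrK.
  by apply: le_lt_trans (ler_normB _ _) _; lra.
have -> : f y - f z = \sum_(m < n) (f (p m.+1) - f (p m)).
  by rewrite -(big_mkord xpredT (fun m => f (p m.+1) - f (p m))) telescope_sumr// p0 pn.
rewrite -sumrB; apply: le_trans (ler_norm_sum _ _ _) _.
apply: (@le_trans _ _ (\sum_(m < n) (e' * `|y - z|))); last first.
  rewrite sumr_const card_ord -mulr_natl mulrA ler_wpM2r// /e' mulrCA ger_pMr//.
  by rewrite ler_pdivrMr// mul1r ler_nat.
apply: ler_sum => m _; set h := y ord0 m - z ord0 m.
have hyz : `|h| <= `|y - z| by have := coord_norm_le (y - z) m; rewrite !mxE.
pose D := 'D_(delta_mx ord0 m) f.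
(* Subtracting the linear part first leaves a function whose slope is at most [e']. *)
have := @mean_value_bound R (fun s : R => f (p m + s *: delta_mx ord0 m) - s * D x)
  (fun s => D (p m + s *: delta_mx ord0 m) - D x) (d * (2 / 3)) e' _ _ h (le_lt_trans hyz yz).
rewrite /= scale0r addr0 mul0r subr0 -pS => H.
rewrite (_ : _ - _ - _ = f (p m.+1) - h * D x - f (p m)); last by rewrite addrAC.
apply: le_trans (H _ _) _; last by rewrite ler_pM2l.
- move=> s _; apply: is_deriveB; first exact: derive_line.
  have -> : (fun s : R => s * D x) = D x \*: (id : R -> R).
    by apply: funext => u; exact: mulrC.
  have := is_deriveZ (D x : R) (is_derive_id s (1 : R)).
  by rewrite [D x *: 1]mulr1.
- move=> s sd; rewrite distrC ltW//; apply: dP => /=.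
  rewrite opprD addrA; apply: le_lt_trans (ler_normB _ _) _.
  have := @delta_norm_le1 R n m; rewrite normrZ => d1.
  have : `|s| * `|delta_mx ord0 m : 'rV[R]_n| <= `|s| by rewrite ler_piMr.
  by have := px m; lra.
Qed.

Lemma strict_deriv_smooth {R : realType} {n : nat} (f : 'rV[R]_n -> R) (x : 'rV[R]_n) :
  smooth_fun f -> strict_deriv f x (fun k => 'D_(delta_mx ord0 k) f x).
Proof.
move=> sf; apply: strict_deriv_C1 => [k y|k].
- by have [_] := sf [::]; apply.
- by have [] := sf [:: k].
Qed.

(** Chain rule for a selection of coordinates. [s] may repeat a coordinate, as happens for [x_k],
    which enters a coupling term both alone and within [x_A]; hence the sum over the fibre of
    [s]. *)
Lemma strict_deriv_sel {R : realType} {m n : nat} (f : 'rV[R]_m -> R) (s : 'I_m -> 'I_n)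
    (x : 'rV[R]_n) (c : 'I_m -> R) :
  strict_deriv f (\row_a x ord0 (s a)) c ->
  strict_deriv (fun y : 'rV[R]_n => f (\row_a y ord0 (s a))) x
    (fun l => \sum_(a | s a == l) c a).
Proof.
move=> fx e e0; have [d d0 H] := fx e e0; exists d => // y z yx zx.
have sel (u v : 'rV[R]_n) : `|(\row_a u ord0 (s a)) - (\row_a v ord0 (s a))| <= `|u - v|.
  by apply: row_norm_le => // a; rewrite !mxE; have := coord_norm_le (u - v) (s a); rewrite !mxE.
have -> : \sum_l (y ord0 l - z ord0 l) * (\sum_(a | s a == l) c a) =
    \sum_a ((\row_a y ord0 (s a)) ord0 a - (\row_a z ord0 (s a)) ord0 a) * c a.
  rewrite [RHS](partition_big s xpredT)//=; apply: eq_bigr => l _.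
  by rewrite mulr_sumr; apply: eq_bigr => a /eqP <-; rewrite !mxE.
apply: le_trans (H _ _ _ _) _; [exact: le_lt_trans (sel _ _) yx|exact: le_lt_trans (sel _ _) zx|].
by rewrite ler_pM2l.
Qed.

Lemma strict_derivD {R : realType} {n : nat} (f g : 'rV[R]_n -> R) (x : 'rV[R]_n) (c d : 'I_n -> R) :
  strict_deriv f x c -> strict_deriv g x d ->
  strict_deriv (fun y => f y + g y) x (fun l => c l + d l).
Proof.
move=> fx gx e e0; have e20 : 0 < e / 2 by rewrite divr_gt0.
have [d1 d10 H1] := fx _ e20; have [d2 d20 H2] := gx _ e20.
exists (Num.min d1 d2) => [|y z]; first by rewrite lt_min d10.
rewrite !lt_min => /andP[y1 y2] /andP[z1 z2].
under eq_bigr do rewrite mulrDr.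
rewrite big_split/=.
set S1 := \sum_l _; set S2 := \sum_l _.
have -> : f y + g y - (f z + g z) - (S1 + S2) = (f y - f z - S1) + (g y - g z - S2) by ring.
apply: le_trans (ler_normD _ _) _.
by have := H1 y z y1 z1; have := H2 y z y2 z2; rewrite -/S1 -/S2; lra.
Qed.

Lemma strict_derivN {R : realType} {n : nat} (f : 'rV[R]_n -> R) (x : 'rV[R]_n) (c : 'I_n -> R) :
  strict_deriv f x c -> strict_deriv (fun y => - f y) x (fun l => - c l).
Proof.
move=> fx e e0; have [d d0 H] := fx e e0; exists d => // y z yx zx.
under eq_bigr do rewrite mulrN.
rewrite sumrN; set S := \sum_l _.
have -> : - f y - - f z - - S = - (f y - f z - S) by ring.
by rewrite normrN; exact: H.
Qed.

Lemma strict_deriv_sum {R : realType} {n : nat} {I : Type} (s : seq I) (P : pred I)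
    (f : I -> 'rV[R]_n -> R) (x : 'rV[R]_n) (c : I -> 'I_n -> R) :
  (forall i, P i -> strict_deriv (f i) x (c i)) ->
  strict_deriv (fun y => \sum_(i <- s | P i) f i y) x
    (fun l => \sum_(i <- s | P i) c i l).
Proof.
move=> H; elim: s => [|i s IH].
  move=> e e0; exists 1 => // y z _ _; rewrite !big_nil subrr sub0r normrN.
  rewrite big1 ?normr0 ?mulr_ge0// ?ltW// => l _.
  by rewrite big_nil mulr0.
have [Pi|nPi] := boolP (P i); last first.
  rewrite (_ : (fun y => _) = (fun y => \sum_(i <- s | P i) f i y)); last first.
    by apply: funext => y; rewrite big_cons (negbTE nPi).
  rewrite (_ : (fun l => _) = (fun l => \sum_(i <- s | P i) c i l))//.
  by apply: funext => y; rewrite big_cons (negbTE nPi).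
rewrite (_ : (fun y => _) = (fun y => f i y + \sum_(i <- s | P i) f i y)); last first.
  by apply: funext => y; rewrite big_cons Pi.
rewrite (_ : (fun l => _) = (fun l => c i l + \sum_(i <- s | P i) c i l)).
  by apply: strict_derivD => //; exact: H.
by apply: funext => y; rewrite big_cons Pi.
Qed.

Lemma strict_deriv_is_derive {R : realType} {n : nat} (f : 'rV[R]_n -> R) (x : 'rV[R]_n)
    (c : 'I_n -> R) (l : 'I_n) :
  strict_deriv f x c -> 'D_(delta_mx ord0 l) f x = c l.
Proof.
move=> fx; apply/cvg_lim => //=; apply/cvgrPdist_le => /= e e0.
have [d d0 H] := fx e e0; near=> h.
have h0 : h != 0 by near: h; exact: nbhs_dnbhs_neq.
have hd : `|h| < d by near: h; exact: dnbhs0_lt.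
have hl : `|h *: delta_mx ord0 l : 'rV[R]_n| <= `|h|.
  by rewrite normrZ ler_piMr// delta_norm_le1.
have := H (h *: delta_mx ord0 l + x) x; rewrite addrK subrr normr0.
move=> /(_ (le_lt_trans hl hd) d0).
rewrite (bigD1 l)//= big1 ?addr0; last first.
  by move=> k kl; rewrite !mxE eqxx (negbTE kl)/= mulr0 add0r subrr mul0r.
rewrite !mxE !eqxx mulr1 addrK => Hh.
have -> : c l - h^-1 *: (f (h *: delta_mx ord0 l + x) - f x) =
   - (h^-1 * (f (h *: delta_mx ord0 l + x) - f x - h * c l)).
  by rewrite /GRing.scale/=; field.
rewrite normrN normrM normfV ler_pdivrMl ?normr_gt0// [leRHS]mulrC.
by apply: le_trans Hh _; rewrite ler_pM2l.
Unshelve. all: end_near. Qed.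

Lemma strict_deriv_lipschitz {R : realType} {n : nat} (f : 'rV[R]_n -> R) (x : 'rV[R]_n)
    (c : 'I_n -> R) :
  strict_deriv f x c -> exists L d : R, [/\ 0 < L, 0 < d & forall y z,
    `|y - x| < d -> `|z - x| < d -> `|f y - f z| <= L * `|y - z|].
Proof.
move=> fx; have [d d0 H] := fx 1 ltr01; exists (1 + \sum_l `|c l|), d; split=> //.
  by rewrite ltr_pwDl// sumr_ge0.
move=> y z yx zx; rewrite mulrDl -[f y - f z](subrK (\sum_l (y ord0 l - z ord0 l) * c l)).
apply: le_trans (ler_normD _ _) _; rewrite lerD ?H//.
apply: le_trans (ler_norm_sum _ _ _) _; rewrite mulr_suml; apply: ler_sum => l _.
rewrite normrM mulrC ler_wpM2l//.
by have := coord_norm_le (y - z) l; rewrite !mxE.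
Qed.

(** * Invariant sets *)

(** Precomposing [V] with the projection [P] onto a small cube around [x0] makes it globally
    Lipschitz, so that [picard] applies. For short times the solution stays in the cube, where [P]
    is the identity. *)
Lemma local_solution {R : realType} {n : nat} (V : 'rV[R]_n -> 'rV[R]_n) (x0 : 'rV[R]_n)
    (c : 'I_n -> 'I_n -> R) :
  (forall k, strict_deriv (fun x => V x ord0 k) x0 (c k)) ->
  exists2 d : R, 0 < d & exists2 y : R -> 'rV[R]_n, y 0 = x0 & is_solution V (ball 0 d) y.
Proof.
move=> Vx.
have /choice[Ld Ldk] : forall k, exists Ld : R * R, [/\ 0 < Ld.1, 0 < Ld.2 & forall y z,
    `|y - x0| < Ld.2 -> `|z - x0| < Ld.2 -> `|V y ord0 k - V z ord0 k| <= Ld.1 * `|y - z|].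
  by move=> k; have [L [d H]] := strict_deriv_lipschitz _ _ _ (Vx k); exists (L, d).
pose L := 1 + \sum_k (Ld k).1; pose d := \big[Num.min/(1 : R)]_k (Ld k).2.
have L0 : 0 < L.
  by rewrite ltr_pwDl// sumr_ge0// => k _; case: (Ldk k) => /ltW.
have d0 : 0 < d by apply: lt_bigmin => // k _; case: (Ldk k).
have VL y z : `|y - x0| < d -> `|z - x0| < d -> `|V y - V z| <= L * `|y - z|.
  move=> yx zx; apply: row_norm_le => [|k]; first by rewrite mulr_ge0// ltW.
  have [_ _ H] := Ldk k; rewrite !mxE.
  have dk : d <= (Ld k).2 by exact: bigmin_le_cond.
  apply: le_trans (H _ _ (lt_le_trans yx dk) (lt_le_trans zx dk)) _.
  rewrite ler_wpM2r// /L (bigD1 k)//= addrCA lerDl addr_ge0// sumr_ge0// => l _.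
  by case: (Ldk l) => /ltW.
pose P (x : 'rV[R]_n) : 'rV[R]_n := \row_k clip (x0 ord0 k) (d / 2) (x ord0 k).
have d20 : 0 < d / 2 by rewrite divr_gt0.
have Px0 x : `|P x - x0| < d.
  apply: (@le_lt_trans _ _ (d / 2)); last by lra.
  by apply: row_norm_le => [|k]; [exact: ltW|rewrite !mxE clip_near// ltW].
have PL x y : `|P x - P y| <= `|x - y|.
  apply: row_norm_le => // k; rewrite !mxE; apply: le_trans (clip_lip _ _ _ _) _.
  by have := coord_norm_le (x - y) k; rewrite !mxE.
have WL x y : `|V (P x) - V (P y)| <= L * `|x - y|.
  by apply: le_trans (VL _ _ (Px0 _) (Px0 _)) _; rewrite ler_pM2l.
have [a a0 [y [y0 yd]]] := @picard R n (fun x => V (P x)) L x0 L0 WL.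
have yc : {for 0, continuous y}.
  by apply: is_derive_continuous; apply: yd; rewrite normr0.
have : \forall t \near (0 : R), `|y t - x0| < d / 2.
  by near=> t; rewrite distrC -y0; near: t; exact: cvgr_dist_lt.
move=> /nbhs_normP[b /= b0 yb].
exists (Num.min a b); first by rewrite lt_min a0.
exists y => // t; rewrite -ball_normE /ball_/= sub0r normrN lt_min => /andP[ta tb].
have -> : y t = P (y t).
  have yt : `|y t - x0| < d / 2 by apply: yb; rewrite /= sub0r normrN.
  apply/rowP => k; rewrite mxE clip_id//.
  by have := coord_norm_le (y t - x0) k; rewrite !mxE => /le_trans; apply; exact: ltW.
exact: yd.
Unshelve. all: end_near. Qed.

Lemma open_interval_ball {R : realType} (d : R) : open_interval (ball (0 : R) d).
Proof.
split; first exact: ball_open.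
move=> s t u; rewrite -ball_normE /ball_/= !sub0r !normrN !ltr_norml.
by move=> /andP[? ?] /andP[? ?] /andP[? ?]; apply/andP; split; lra.
Qed.

(** The local solution through [x] stays in [S], so its coordinates [k] and [l] agree near time 0,
    and so do their derivatives there. *)
Lemma dyn_invariant_eq_coord {R : realType} {n : nat} (V : 'rV[R]_n -> 'rV[R]_n)
    (S : set 'rV[R]_n) (k l : 'I_n) (c : 'rV[R]_n -> 'I_n -> 'I_n -> R) :
  (forall x k, strict_deriv (fun y => V y ord0 k) x (c x k)) ->
  dyn_invariant V S -> (forall x, S x -> x ord0 k = x ord0 l) ->
  forall x, S x -> V x ord0 k = V x ord0 l.
Proof.
move=> Vd VS Skl x Sx.
have [d d0 [y y0 ys]] := local_solution V x (c x) (Vd x).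
have I0 : ball (0 : R) d 0 by exact: ballxx.
have yk : \forall t \near (0 : R), y t ord0 k = y t ord0 l.
  apply/nbhs_ballP; exists d => // t It /=.
  by apply/Skl/(VS _ y (open_interval_ball d) ys 0 t) => //; rewrite y0.
have := ys _ I0; rewrite y0 => y'.
have dk := is_derive_coord _ _ _ k y'; have dl := is_derive_coord _ _ _ l y'.
have [_ <-] := near_eq_is_derive yk dk; exact: derive_val.
Qed.

(** * Linearization of the network at the diagonal *)

(** Turns an identity [V_k = V_l] holding along a line into a linear relation between two rows of
    the Jacobian. *)
Lemma strict_deriv_invariant_dir {R : realType} {n : nat} (f : 'rV[R]_n -> R)
    (x v : 'rV[R]_n) (c : 'I_n -> R) :
  strict_deriv f x c -> (forall h, f (x + h *: v) = f x) ->
  \sum_l v ord0 l * c l = 0.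
Proof.
move=> fx fv; apply/eqP; rewrite -normr_le0; apply/ler_addgt0Pr => e e0; rewrite add0r.
pose e' := e / (1 + `|v|).
have v0 : 0 < 1 + `|v| by rewrite ltr_pwDl.
have e'0 : 0 < e' by rewrite divr_gt0.
have [d d0 H] := fx _ e'0.
have [h h0 hv] : exists2 h, 0 < h & `|h *: v| < d.
  exists (d / (1 + `|v|)); first by rewrite divr_gt0.
  by rewrite normrZ gtr0_norm ?divr_gt0// mulrAC -mulrA gtr_pMr// ltr_pdivrMr// mul1r ltrDr.
have := H (x + h *: v) x; rewrite (_ : x + h *: v - x = h *: v); last first.
  by rewrite addrAC subrr add0r.
rewrite fv subrr normr0 => /(_ hv d0); rewrite subrr sub0r normrN.
under eq_bigr do rewrite !mxE addrAC subrr add0r -mulrA.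
rewrite -mulr_sumr normrM normrZ (gtr0_norm h0) mulrCA ler_pM2l// => /le_trans; apply.
by rewrite /e' mulrAC -mulrA ger_pMr// ler_pdivrMr// mul1r lerDr.
Qed.

Section NetworkLinearization.
Context {R : realType} {N : nat}.
Variables (E : {set {set 'I_N}}) (F : R -> R) (G : forall n : nat, R -> 'rV[R]_n -> R).
Hypothesis F_smooth : smooth_fun1 F.
Hypothesis G_smooth : forall n, (0 < n)%N -> smooth_coupling (G n).
Hypothesis G_sym : forall n, (0 < n)%N -> symmetric_coupling (G n).

(** The same packing of arguments as in [smooth_coupling], so that smoothness of [G n] applies
    verbatim. *)
Definition uncurried_coupling (n : nat) (z : 'rV[R]_(1 + n)) : R :=
  G n (z ord0 (lshift n ord0)) (\row_(k < n) z ord0 (rshift 1 k)).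

(** The node whose state fills argument slot [a] in the coupling term of [A] acting on [k]: first
    [k] itself, then the nodes of [A]. *)
Definition edge_index (k : 'I_N) (A : {set 'I_N}) (a : 'I_(1 + #|A|)) : 'I_N :=
  match fintype.split a with inl _ => k | inr b => enum_val b end.

Lemma edge_index_lshift k A b : edge_index k A (lshift #|A| b) = k.
Proof. by rewrite /edge_index (unsplitK (inl b)). Qed.

Lemma edge_index_rshift k A b : edge_index k A (rshift 1 b) = enum_val b.
Proof. by rewrite /edge_index (unsplitK (inr b)). Qed.

Definition edge_partial (x : 'rV[R]_N) (k l : 'I_N) (A : {set 'I_N}) : R :=
  \sum_(a | edge_index k A a == l)
    'D_(delta_mx ord0 a) (uncurried_coupling #|A|) (\row_a x ord0 (edge_index k A a)).

(** The entry [(k, l)] of the Jacobian. The first sum is [F'(x_k)] times a Kronecker delta, in the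
    shape that [strict_deriv_sel] produces. *)
Definition net_partial (x : 'rV[R]_N) (k l : 'I_N) : R :=
  \sum_(a : 'I_1 | k == l)
     'D_(delta_mx ord0 a) (fun z : 'rV[R]_1 => F (z ord0 ord0)) (\row_(_ < 1) x ord0 k) +
  \sum_(A in E | k \in A) edge_partial x k l A.

Lemma strict_deriv_net_vf (x : 'rV[R]_N) (k : 'I_N) :
  strict_deriv (fun y => net_vf E F G y ord0 k) x (net_partial x k).
Proof.
rewrite (_ : (fun y => _) = (fun y : 'rV[R]_N =>
    F ((\row_(_ < 1) y ord0 k) ord0 ord0) + \sum_(A in E | k \in A)
      uncurried_coupling #|A| (\row_a y ord0 (edge_index k A a)))); last first.
  apply: funext => y; rewrite !mxE; congr (_ + _); apply: eq_bigr => A _.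
  rewrite /uncurried_coupling mxE edge_index_lshift; congr (G _ _ _).
  by apply/rowP => b; rewrite !mxE edge_index_rshift.
apply: strict_derivD.
  apply: (strict_deriv_sel (fun z : 'rV[R]_1 => F (z ord0 ord0)) (fun=> k)).
  exact: strict_deriv_smooth.
apply: strict_deriv_sum => A /andP[_ kA].
apply: strict_deriv_sel; apply: strict_deriv_smooth; apply: G_smooth.
by apply/card_gt0P; exists k.
Qed.

Lemma jacobian_net_vf (x : 'rV[R]_N) (k l : 'I_N) :
  Defs.jacobian (net_vf E F G) x k l = net_partial x k l.
Proof. by rewrite mxE; exact: (strict_deriv_is_derive _ _ _ l (strict_deriv_net_vf x k)). Qed.

(** Transposing slots [b] and [b'] fixes the constant base point and exchanges the two increments,
    so the difference quotients already coincide. *)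
Lemma coupling_partial_const (n : nat) (p : R) (b b' : 'I_n) : (0 < n)%N ->
  'D_(delta_mx ord0 (rshift 1 b)) (uncurried_coupling n) (const_mx p) =
  'D_(delta_mx ord0 (rshift 1 b')) (uncurried_coupling n) (const_mx p).
Proof.
move=> n0; pose q (b : 'I_n) (h : R) := h^-1 *: (uncurried_coupling n
  (h *: delta_mx ord0 (rshift 1 b) + const_mx p) - uncurried_coupling n (const_mx p)).
suff E' : q b = q b' by rewrite /derive /= -/(q b) E'.
apply: funext => h; congr (_ *: (_ - _)); rewrite /uncurried_coupling !mxE /= !mulr0.
rewrite -(G_sym n n0 (tperm b b')); congr (G _ _ _); apply/rowP => k.
rewrite !mxE /= !(inj_eq (@rshift_inj 1 n)).
have -> // : (tperm b b' k == b) = (k == b').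
by rewrite -[X in _ == X](tpermR b b') (inj_eq perm_inj).
Qed.

Lemma edge_partial_diagonal (x : 'rV[R]_N) (k l : 'I_N) (A : {set 'I_N}) (p : R) :
  x = const_mx p -> k != l ->
  edge_partial x k l A = \sum_(b | enum_val b == l)
    'D_(delta_mx ord0 (rshift 1 b)) (uncurried_coupling #|A|) (const_mx p).
Proof.
move=> -> kl; rewrite /edge_partial (_ : \row_a _ = const_mx p); last first.
  by apply/rowP => a; rewrite !mxE.
rewrite big_mkcond big_split_ord/= big1 ?add0r; last first.
  by move=> a _; rewrite edge_index_lshift (negbTE kl).
by rewrite -big_mkcond/=; apply: eq_bigl => b; rewrite edge_index_rshift.
Qed.

Lemma edge_partial_notin (x : 'rV[R]_N) (k l : 'I_N) (A : {set 'I_N}) :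
  k != l -> l \notin A -> edge_partial x k l A = 0.
Proof.
move=> kl lA; rewrite /edge_partial big1// => a.
rewrite -[a]splitK; case: (fintype.split a) => b /=.
  by rewrite edge_index_lshift (negbTE kl).
by rewrite edge_index_rshift => /eqP lb; rewrite -lb enum_valP in lA.
Qed.

(** Off the Jacobian's diagonal only the slots of [x_A] count, and each node of [A] fills exactly
    one of them; at a point of the diagonal all these slots have the same partial derivative. *)
Lemma edge_partial_sym (x : 'rV[R]_N) (k l : 'I_N) (A : {set 'I_N}) :
  diagonal_set N x -> k != l -> k \in A -> l \in A ->
  edge_partial x k l A = edge_partial x l k A.
Proof.
move=> xD kl kA lA.
have xp : x = const_mx (x ord0 k) by apply/rowP => m; rewrite mxE; exact: xD.
have A0 : (0 < #|A|)%N by apply/card_gt0P; exists k.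
rewrite (edge_partial_diagonal _ _ _ _ _ xp kl).
rewrite (edge_partial_diagonal _ _ _ _ _ xp) 1?eq_sym//.
have one (m : 'I_N) (mA : m \in A) (c : 'I_#|A| -> R) :
    \sum_(b | enum_val b == m) c b = c (enum_rank_in mA m).
  rewrite (big_pred1 (enum_rank_in mA m))// => b.
  by rewrite /= -(inj_eq enum_val_inj) enum_rankK_in.
by rewrite (one k kA) (one l lA); exact: coupling_partial_const.
Qed.

(** For [k != l], a hyperedge contributes to either entry only if it contains both nodes, and then
    it contributes equally to both. *)
Lemma net_partial_sym (x : 'rV[R]_N) (k l : 'I_N) :
  diagonal_set N x -> net_partial x k l = net_partial x l k.
Proof.
move=> xD; have [->//|kl] := eqVneq k l.
rewrite /net_partial [X in X + _]big_pred0; last by move=> ?; rewrite (negbTE kl).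
rewrite [in RHS]big_pred0; last by move=> ?; rewrite eq_sym (negbTE kl).
rewrite !add0r big_mkcondr [RHS]big_mkcondr/=; apply: eq_bigr => A _.
case: ifPn => kA; case: ifPn => lA //.
- exact: edge_partial_sym.
- exact: edge_partial_notin.
- by rewrite edge_partial_notin// eq_sym.
Qed.

(** The line through [x] in direction [(1, ..., 1)] stays in the diagonal, where [V_k - V_l]
    vanishes. *)
Lemma net_partial_row_sum (x : 'rV[R]_N) (k l : 'I_N) :
  dyn_invariant (net_vf E F G) (diagonal_set N) -> diagonal_set N x ->
  \sum_m net_partial x k m = \sum_m net_partial x l m.
Proof.
move=> inv xD.
have eqD := dyn_invariant_eq_coord _ _ k l _ strict_deriv_net_vf inv (fun y yD => yD k l).
have dkl := strict_derivD _ _ _ _ _ (strict_deriv_net_vf x k)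
  (strict_derivN _ _ _ (strict_deriv_net_vf x l)).
have kl0 h : net_vf E F G (x + h *: const_mx 1) ord0 k - net_vf E F G (x + h *: const_mx 1) ord0 l =
    net_vf E F G x ord0 k - net_vf E F G x ord0 l.
  by rewrite !eqD ?subrr// => a b; rewrite !mxE; congr (_ + _); exact: xD.
have := strict_deriv_invariant_dir _ _ (const_mx 1) _ dkl kl0.
under eq_bigr do rewrite mxE mul1r.
by rewrite sumrB => /eqP; rewrite subr_eq0 => /eqP.
Qed.

(** Moving only coordinate [i] from a diagonal point stays in [S_set i], where [V_k - V_l]
    vanishes. *)
Lemma net_partial_S_set (x : 'rV[R]_N) (i k l : 'I_N) :
  dyn_invariant (net_vf E F G) (S_set i) -> diagonal_set N x ->
  k != i -> l != i -> net_partial x k i = net_partial x l i.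
Proof.
move=> inv xD ki li.
have eqS := dyn_invariant_eq_coord _ _ k l _ strict_deriv_net_vf inv (fun y yS => yS k l ki li).
have dkl := strict_derivD _ _ _ _ _ (strict_deriv_net_vf x k)
  (strict_derivN _ _ _ (strict_deriv_net_vf x l)).
have kl0 h : net_vf E F G (x + h *: delta_mx ord0 i) ord0 k -
    net_vf E F G (x + h *: delta_mx ord0 i) ord0 l =
    net_vf E F G x ord0 k - net_vf E F G x ord0 l.
  have Sx : S_set i x by move=> a b _ _; exact: xD.
  rewrite (eqS _ Sx) (eqS (x + h *: delta_mx ord0 i)) ?subrr// => a b ai bi.
  by rewrite !mxE (negbTE ai) (negbTE bi) andbF mulr0 !addr0; exact: xD.
have := strict_deriv_invariant_dir _ _ (delta_mx ord0 i) _ dkl kl0.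
rewrite (bigD1 i)//= big1 ?addr0; last first.
  by move=> m mi; rewrite mxE (negbTE mi) andbF mul0r.
by rewrite mxE !eqxx mul1r => /eqP; rewrite subr_eq0 => /eqP.
Qed.

End NetworkLinearization.

(** * Transverse dynamics *)

Lemma is_derive_reverse {R : realType} (f : R -> R) (t d : R) :
  is_derive (- t) 1 f d -> is_derive t 1 (fun s => f (- s)) (- d).
Proof.
case=> fd <-; have [nd nE] := is_deriveNid t (1 : R).
split; first by apply/derivable1_diffP; apply: differentiable_comp; apply/derivable1_diffP.
rewrite -!derive1E (derive1_comp nd fd).
by rewrite (derive1E -%R) nE mulrN1.
Qed.

(** The estimate forces [w * dw >= 0], so [w ^ 2] is eventually nondecreasing; being nonzero, it
    stays away from 0. *)
Lemma exponential_growth_not_cvg0 {R : realType} (w dw : R -> R) (mu : R) :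
  (forall t : R, is_derive t 1 w (dw t)) -> (forall t, w t != 0) ->
  (\forall t \near +oo, `|dw t - mu * w t| <= mu * `|w t|) ->
  ~ (w t @[t --> +oo] --> 0).
Proof.
move=> wd w0 [T [_ wT]] wlim.
have sqd (t : R) : is_derive t 1 (fun t => w t * w t) (2 * (w t * dw t)).
  by apply: is_derive_eq (is_deriveM (wd t) (wd t)) _; rewrite /GRing.scale/=; ring.
have mono (t : R) : T + 1 <= t -> w (T + 1) * w (T + 1) <= w t * w t.
  move=> Tt; apply: (@ger0_derive1_ndecry R (fun t => w t * w t) (T + 1)) => //.
  - move=> s; rewrite in_itv/= andbT => Ts; rewrite derive1E; case: (sqd s) => _ ->.
    rewrite mulr_ge0//.
    have /wT /= : T < s by lra.
    have [ws|/ltW ws] := leP 0 (w s).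
      by rewrite (ger0_norm ws) ler_norml => /andP[? _]; rewrite mulr_ge0//; lra.
    by rewrite (ler0_norm ws) ler_norml => /andP[_ ?]; rewrite mulr_le0//; lra.
  - by apply: derivable_within_continuous => s _; case: (sqd s).
have wT0 : 0 < `|w (T + 1)| by rewrite normr_gt0.
have near1 : \forall t \near +oo, `|w t| < `|w (T + 1)|.
  by apply: cvgr_norm_lt wlim _ _; rewrite normr0.
have [t [Tt]] : exists t, T + 1 <= t /\ `|w t| < `|w (T + 1)|.
  near (pinfty_nbhs R) => t; exists t; split; near: t; last exact: near1.
  by apply: nbhs_pinfty_ge; rewrite num_real.
apply/negP; rewrite -leNgt -ler_sqr ?nnegrE// !real_normK ?num_real// !expr2.
exact: mono.
Unshelve. all: end_near. Qed.

(* In [S_set i] the transverse coordinate is [w = y_i - y_j]; since [f] vanishes on the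
   diagonal, [w' = f (y) = (c i + o(1)) w] as [y] approaches [xi]. *)
Lemma transverse_nonpos {R : realType} {N : nat} (f : 'rV[R]_N -> R) (xi : 'rV[R]_N)
    (c : 'I_N -> R) (i j : 'I_N) (y : R -> 'rV[R]_N) :
  i != j -> strict_deriv f xi c -> diagonal_set N xi ->
  (forall x, diagonal_set N x -> f x = 0) ->
  (forall t : R, is_derive t 1 (fun t => y t ord0 i - y t ord0 j) (f (y t))) ->
  (forall t, (S_set i `\` diagonal_set N) (y t)) ->
  y t @[t --> +oo] --> xi -> c i <= 0.
Proof.
move=> ij fc xiD fD yd yS yxi; rewrite leNgt; apply/negP => ci.
have yj t l : l != i -> y t ord0 l = y t ord0 j.
  by move=> li; have [Sy _] := yS t; apply: Sy => //; rewrite eq_sym.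
apply: (@exponential_growth_not_cvg0 R (fun t => y t ord0 i - y t ord0 j)
  (fun t => f (y t)) (c i)) => //.
- move=> t; rewrite subr_eq0; apply/eqP => yij; have [_] := yS t; apply => k l.
  by have [->|/yj->] := eqVneq k i; have [->|/yj->] := eqVneq l i.
(* The tolerance is [c i] itself, which is exactly the error that the growth lemma allows. *)
- have [d d0 H] := fc _ ci.
  near=> t.
  have yt : `|y t - xi| < d by rewrite distrC; near: t; exact: cvgr_dist_lt.
  set w := y t ord0 i - y t ord0 j.
  (* The diagonal point [const_mx (y t ord0 j)] differs from [y t] only in coordinate [i], and [f]
     vanishes there; strict differentiability compares the two. *)
  have dw : y t - const_mx (y t ord0 j) = w *: delta_mx ord0 i.
    apply/rowP => l; rewrite !mxE; have [->|li] := eqVneq l i; first by rewrite eqxx mulr1.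
    by rewrite (yj _ _ li) subrr andbF mulr0.
  have zt : `|const_mx (y t ord0 j) - xi| < d.
    apply: le_lt_trans yt; apply: row_norm_le => // l.
    by rewrite !mxE (xiD l j); have := coord_norm_le (y t - xi) j; rewrite !mxE.
  have := H _ _ yt zt; rewrite (fD (const_mx _)); last by move=> k l; rewrite !mxE.
  rewrite dw (bigD1 i)//= big1 ?addr0 ?subr0; last first.
    by move=> l li; rewrite mxE (yj _ _ li) subrr mul0r.
  rewrite mxE -/w mulrC => /le_trans; apply.
  by rewrite ler_pM2l// normrZ ler_piMr// delta_norm_le1.
- rewrite -(subrr (xi ord0 i)) [X in _ - X](xiD i j); apply: cvgB.
  + exact: (cvg_comp _ _ yxi (@coord_continuous R 1 N ord0 i xi)).
  + exact: (cvg_comp _ _ yxi (@coord_continuous R 1 N ord0 j xi)).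
Unshelve. all: end_near. Qed.

(** [eigenvalue] acts on row vectors, and the eigenvector is [e_i - e_j]: by symmetry rows [i] and
    [j] of [J] are both [a] off the diagonal, so their difference is supported on [i] and [j]. *)
Lemma eigenvalue_delta_diff {R : realType} {N : nat} (J : 'M[R]_N) (i j : 'I_N) (a : R) :
  i != j -> (forall k l, J k l = J l k) ->
  (forall k, k != i -> J k i = a) -> (forall k, k != j -> J k j = a) ->
  J i i = J j j ->
  eigenvalue (map_mx (real_complex R) J) (real_complex R (J i i - a)).
Proof.
move=> ij Jsym Ji Jj Jij; apply/eigenvalueP.
exists (map_mx (real_complex R) (delta_mx ord0 i - delta_mx ord0 j)).
- rewrite -map_mxM -map_mxZ; congr map_mx; rewrite mulmxBl -!rowE.
  apply/rowP => k; rewrite !mxE eqxx/=.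
  have [->|ki] := eqVneq k i.
    by rewrite (negbTE ij) subr0 mulr1 (Jsym j i) (Jj i ij) .
  have [->|kj] := eqVneq k j.
    by rewrite sub0r mulrN1 (Jsym i j) (Ji j) 1?eq_sym// Jij opprB.
  by rewrite (Jsym i) (Jsym j) Ji// Jj// !subrr mulr0.
- rewrite map_mx_eq0 subr_eq0; apply/eqP => /rowP /(_ i) /eqP.
  by rewrite !mxE !eqxx (negbTE ij) oner_eq0.
Qed.

Theorem mainTheorem13 (R : realType) (N : nat) (E : {set {set 'I_N}})
    (F : R -> R) (G : forall n : nat, R -> 'rV[R]_n -> R) :
  (3 <= N)%N ->
  (forall A, A \in E -> A != finset.set0) ->
  smooth_fun1 F ->
  (forall n, (0 < n)%N -> smooth_coupling (G n)) ->
  (forall n, (0 < n)%N -> symmetric_coupling (G n)) ->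
  (forall n, (0 < n)%N -> nontrivial_coupling (G n)) ->
  ~ (exists (i j : 'I_N) (xi1 xi2 : 'rV[R]_N),
        i != j /\
        dyn_invariant (net_vf E F G) (diagonal_set N) /\
        dyn_invariant (net_vf E F G) (S_set i) /\
        dyn_invariant (net_vf E F G) (S_set j) /\
        xi1 != xi2 /\
        diagonal_set N xi1 /\ diagonal_set N xi2 /\
        is_equilibrium (net_vf E F G) xi1 /\ is_equilibrium (net_vf E F G) xi2 /\
        hyperbolic (net_vf E F G) xi1 /\ hyperbolic (net_vf E F G) xi2 /\
        heteroclinic_in (net_vf E F G) xi1 xi2 (S_set i `\` diagonal_set N) /\
        heteroclinic_in (net_vf E F G) xi2 xi1 (S_set j `\` diagonal_set N)).
Proof.
move=> _ _ Fs Gs Gsym _ [i [j [xi [xi' [ij [invD [invi [invj [_ [xiD]]]]]]]]]].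
move=> [_ [_ [_ [hyp [_ [[y [ys [yxi [_ yS]]]] [z [zs [_ [zxi zS]]]]]]]]]].
have ji : j != i by rewrite eq_sym.
pose V := net_vf E F G; pose J := net_partial E F G xi.
have Vd x k : strict_deriv (fun y => V y ord0 k) x (net_partial E F G x k).
  exact: strict_deriv_net_vf.
have Jsym k l : J k l = J l k by exact: net_partial_sym.
have Ji k : k != i -> J k i = J j i.
  by move=> ki; apply: net_partial_S_set.
have Jj k : k != j -> J k j = J j i.
  by move=> kj; rewrite (Jsym j i); apply: net_partial_S_set.
(* By symmetry the off-diagonal parts of rows [i] and [j] are both [N - 1] copies of [J j i], which
   cancel from the equal row sums. *)
have Jij : J i i = J j j.
  have : \sum_m J i m = \sum_m J j m by exact: net_partial_row_sum.
  rewrite (bigD1 i)//= [in RHS](bigD1 j)//=.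
  rewrite (eq_bigr (fun=> J j i)); last by move=> k ki; rewrite Jsym Ji.
  rewrite [in RHS](eq_bigr (fun=> J j i)); last by move=> k kj; rewrite Jsym Jj.
  by rewrite !sumr_const !cardC1 => /addIr.
have mu0 : J i i - J j i != 0.
  apply/eqP => mu0; have /negP := hyp 0 (raddf0 _); apply.
  have -> : Defs.jacobian V xi = \matrix_(k, l) J k l.
    by apply/matrixP => k l; rewrite jacobian_net_vf// mxE.
  have := @eigenvalue_delta_diff R N (\matrix_(k, l) J k l) i j (J j i) ij.
  rewrite !mxE mu0 rmorph0; apply => //.
  - by move=> k l; rewrite !mxE.
  - by move=> k ki; rewrite mxE Ji.
  - by move=> k kj; rewrite mxE Jj.
have VD x k l : diagonal_set N x -> V x ord0 k = V x ord0 l.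
  by apply: (dyn_invariant_eq_coord V _ k l _ Vd invD) => w wD; exact: wD.
(* The single function [V_j - V_i] serves both trajectories: with [mu = J i i - J j i], its
   coefficient is [mu] at [j] and [- mu] at [i]. *)
have fij := strict_derivD _ _ _ _ _ (Vd xi j) (strict_derivN _ _ _ (Vd xi i)).
have mu_le0 : J i i - J j i <= 0.
  rewrite Jij -(Jsym i j).
  apply: (transverse_nonpos _ xi _ j i z ji fij xiD _ _ zS zxi) => [x xD|t].
    by rewrite (VD x j i xD) subrr.
  by apply: is_deriveB; apply: is_derive_coord; exact: zs.
have mu_ge0 : 0 <= J i i - J j i.
  rewrite -oppr_le0 opprB.
  (* Reversing time makes the trajectory leaving [xi] arrive there; its transverse coordinate
     [y_i - y_j] then has derivative [V_j - V_i]. *)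
  apply: (transverse_nonpos _ xi _ i j (y \o -%R) ij fij xiD _ _ _ _) => [x xD|t|t|].
  - by rewrite (VD x j i xD) subrr.
  - have yk k : is_derive t 1 (fun t => y (- t) ord0 k) (- V (y (- t)) ord0 k).
      exact: (is_derive_reverse (fun s => y s ord0 k) t _ (is_derive_coord _ _ _ k (ys (- t) I))).
    by rewrite addrC -[X in _ + X]opprK; apply: is_deriveB; exact: yk.
  - exact: yS.
  - exact/cvgNy_compNP.
by move: mu0; rewrite eq_le mu_le0 mu_ge0.
Qed.
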